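(* Let $k\ge 2$, let $a\colon \mathbb{N}_0 \to \mathbb{C}$ be a $k$-automatic sequence, and let $\alpha \in \mathbb{R}\setminus\mathbb{Q}$. Then $$\lim_{N\to\infty} \mathbb{E}_{n<N}\, a(n)\, e(n\alpha) = 0.$$
   Context: $\mathbb{N}_0=\{0,1,2,\dots\}$, $\mathbb{E}_{n<N}\,x(n)=\frac1N\sum_{n=0}^{N-1}x(n)$, $e(\theta)=e^{2\pi i\theta}$. For an integer $k\ge 2$ let $\Sigma_k=\{0,\dots,k-1\}$ and let $\Sigma_k^*$ be the set of finite words over $\Sigma_k$ (including the empty word). For $n\in\mathbb{N}_0$, $(n)_k\in\Sigma_k^*$ is the base-$k$ expansion of $n$ without leading zeros, most significant digit on the left ($(0)_k$ is the empty word). A $k$-automaton $(S,s_0,\delta,\tau)$ consists of a finite set of states $S$, an initial state $s_0\in S$, a transition function $\delta\colon S\times\Sigma_k\to S$ and an output function $\tau\colon S\to\Delta$. Extend $\delta$ to $S\times\Sigma_k^*$ by $\delta(s,\text{empty word})=s$ and $\delta(s,uv)=\delta(\delta(s,v),u)$ (so the rightmost digit is read first). A sequence $a\colon\mathbb{N}_0\to\Delta$ is $k$-automatic if $a(n)=\tau(\delta(s_0,(n)_k))$ for some $k$-automaton. *)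

(* Defs.v *)
From HB Require Import structures.
From mathcomp Require Import all_boot all_order all_algebra.
From mathcomp Require Import all_classical all_reals all_analysis.
From mathcomp Require Import complex.

Set Implicit Arguments.
Unset Strict Implicit.
Unset Printing Implicit Defensive.

Import Order.TTheory GRing.Theory Num.Theory.
Import numFieldNormedType.Exports.

(* Base-k expansion of n, most significant digit first, without leading zeros
   ([::] for n = 0): up_log k n.+1 is the least L such that n < k ^ L, and
   digit i counted from the right is (n %/ k ^ i) %% k. *)
Definition expansion (k : nat) (hk : 1 < k) (n : nat) : seq 'I_k :=
  rev (mkseq (fun i => Ordinal (ltn_pmod (n %/ k ^ i) (ltnW hk)))
             (up_log k n.+1)).

Lemma expansion0 (k : nat) (hk : 1 < k) : expansion hk 0 = [::].
Proof. by rewrite /expansion up_log1. Qed.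

Lemma expansion_rcons (k : nat) (hk : 1 < k) (n : nat) : 0 < n ->
  expansion hk n =
    rcons (expansion hk (n %/ k)) (Ordinal (ltn_pmod n (ltnW hk))).
Proof.
move=> n0; have k0 : 0 < k by exact: ltnW.
have -> : expansion hk n =
    rev (mkseq (fun i => Ordinal (ltn_pmod (n %/ k ^ i) (ltnW hk)))
               (up_log k (n %/ k).+1).+1).
  congr (rev (mkseq _ _)).
  have small : n %/ k < k ^ up_log k (n %/ k).+1 by apply: up_logP.
  case: (ltnP n k) => [nk|kn].
    rewrite divn_small // up_log1; apply: up_log_eq => //.
    by rewrite expn0 expn1 ltnS n0.
  apply: up_log_eq => //; rewrite expnS mulnC -ltn_divLR // small andbT.
  have q0 : 0 < n %/ k by rewrite divn_gt0.
  have qk := @up_log_gtn k (n %/ k).+1 hk q0.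
  have u0 : 0 < up_log k (n %/ k).+1 by rewrite up_log_gt0 hk.
  by rewrite ltnS -(prednK u0) expnSr -leq_divRL.
rewrite /expansion /mkseq /= rev_cons; congr rcons; last first.
  by apply: val_inj; rewrite /= expn0 divn1.
congr rev; rewrite -[1]/(1 + 0) iotaDl -map_comp; apply: eq_map => i /=.
by apply: val_inj; rewrite /= add1n expnS divnMA.
Qed.

Lemma expansion_value (k : nat) (hk : 1 < k) (n : nat) :
  foldl (fun m (d : 'I_k) => m * k + d) 0 (expansion hk n) = n.
Proof.
elim/ltn_ind: n => -[|n] IH; first by rewrite expansion0.
by rewrite expansion_rcons // foldl_rcons IH ?ltn_Pdiv //= -divn_eq.
Qed.

Lemma expansion_head (k : nat) (hk : 1 < k) (n : nat) (d : 'I_k) : 0 < n ->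
  0 < head d (expansion hk n).
Proof.
elim/ltn_ind: n => n IH n0; rewrite expansion_rcons //.
case: (ltnP n k) => [nk|kn].
  by rewrite divn_small // expansion0 /= modn_small.
have q0 : 0 < n %/ k by rewrite divn_gt0 // ltnW.
have /(_ (ltn_Pdiv hk n0) q0) := IH (n %/ k).
by rewrite (expansion_rcons hk q0) headI /=.
Qed.

Record automaton (k : nat) (Delta : Type) := Automaton {
  state : finType;
  init : state;
  trans : state -> 'I_k -> state;
  out : state -> Delta }.

(* delta(s, u v) = delta(delta(s, v), u): the rightmost digit is read first. *)
Definition trans_word (k : nat) (Delta : Type) (A : automaton k Delta)
    (s : state A) (w : seq 'I_k) : state A :=
  foldr (fun d t => trans t d) s w.

Lemma trans_word_cat (k : nat) (Delta : Type) (A : automaton k Delta)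
    (s : state A) (u v : seq 'I_k) :
  trans_word s (u ++ v) = trans_word (trans_word s v) u.
Proof. exact: foldr_cat. Qed.

Definition automatic (k : nat) (hk : 1 < k) (Delta : Type) (a : nat -> Delta)
    : Prop :=
  exists A : automaton k Delta,
    forall n, a n = out (trans_word (init A) (expansion hk n)).

Local Open Scope ring_scope.
Local Open Scope complex_scope.

Definition e (R : realType) (theta : R) : R[i] :=
  cos (2 * pi * theta) +i* sin (2 * pi * theta).

Definition mean (K : fieldType) (x : nat -> K) (N : nat) : K :=
  N%:R^-1 * \sum_(n < N) x n.

(* Main.v *)
Require Import Defs.
From HB Require Import structures.
From mathcomp Require Import all_boot all_order all_algebra.
From mathcomp Require Import all_classical all_reals all_analysis.
From mathcomp Require Import complex.
From mathcomp Require Import ring lra.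
Import Order.TTheory GRing.Theory Num.Theory.
Import numFieldNormedType.Exports.
Local Open Scope classical_set_scope.
Local Open Scope ring_scope.
Local Open Scope complex_scope.

(** Write w = e(alpha); it has modulus 1 and, alpha being irrational, is not a
    root of unity. Since digits are read from the right, on a block of integers
    n = r + k^L m with r < k^L and m > 0 fixed, a(n) depends on r only through
    the state reached after reading the L low digits of r. Each block of the
    exponential sum is therefore, up to a factor of modulus 1, a sum
    [state_sum] of the form sum_(r < k^L) w^r g(state after r), where g is
    bounded independently of m. It suffices that for some L such sums are at
    most eps k^L sup |g| ([state_sum_bound_small]); summing over blocks and
    bounding trivially the block m = 0 and the last incomplete one then
    concludes.

    The best constants in these bounds are submultiplicative
    ([state_sum_bound_add]): splitting L + j digits into L low and j high ones
    multiplies the constant for (L, w) by the one for (j, w^(k^L)). So it is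
    enough to fix j and gain over the trivial bound k^j by a fixed factor for
    infinitely many L. Take k^j larger than the number of states: from any
    state, two words r < r' of length j lead to the same state, and their
    contributions, u^r and u^r' with u = w^(k^L), partially cancel as soon as
    u^h stays away from 1 for 0 < h < k^j
    ([state_sum_bound_pigeonhole]).

    All these h divide Q = (k^j)!, so this holds when z^(k^L) stays away from
    1, where z = w^Q. That happens for infinitely many L
    ([unit_orbit_away_from_1]): near 1 the map x |-> x^k expands the distance
    to 1 by a factor at least 3/2, so an orbit that never meets 1 cannot
    remain near 1. *)

(** * Powers of complex numbers of modulus 1 *)

Lemma norm_expr_sub1_le {C : numDomainType} {z : C} (n : nat) :
  `|z| = 1 -> `|z ^+ n - 1| <= n%:R * `|z - 1|.
Proof.
move=> z1; rewrite subrX1 normrM mulrC ler_wpM2r //.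
apply: le_trans (ler_norm_sum _ _ _) _.
rewrite -[leRHS](_ : \sum_(i < n) 1 = _); last by rewrite sumr_const card_ord.
by apply: ler_sum => i _; rewrite normrX z1 expr1n.
Qed.

(** The quotient (z^k - 1) / (z - 1) is a sum of k terms each within
    k |z - 1| of 1, hence at distance at most 1/2 from k >= 2. *)
Lemma norm_expr_sub1_ge {C : numFieldType} {z : C} {k : nat} :
  (1 < k)%N -> `|z| = 1 -> `|z - 1| <= (2 * k ^ 2)%:R^-1 ->
  3 / 2 * `|z - 1| <= `|z ^+ k - 1|.
Proof.
move=> k1 z1 small; rewrite subrX1 normrM mulrC ler_wpM2l //.
have k2 : (2 : C) <= k%:R by rewrite ler_nat.
have dev : `|k%:R - \sum_(i < k) z ^+ i| <= 2^-1.
  have -> : k%:R - \sum_(i < k) z ^+ i = \sum_(i < k) (1 - z ^+ i).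
    by rewrite sumrB sumr_const card_ord.
  apply: le_trans (ler_norm_sum _ _ _) _.
  have -> : (2^-1 : C) = \sum_(i < k) (k%:R * (2 * k ^ 2)%:R^-1).
    rewrite sumr_const card_ord -mulr_natl natrM natrX.
    have : k%:R != 0 :> C by rewrite pnatr_eq0; case: (k) k1.
    by move=> ?; field.
  apply: ler_sum => i _; rewrite distrC.
  apply: le_trans (norm_expr_sub1_le i z1) _.
  by apply: ler_pM => //; rewrite ler_nat ltnW.
have := lerB_dist k%:R (k%:R - \sum_(i < k) z ^+ i).
rewrite subKr normr_nat; apply: le_trans.
apply: le_trans (lerB (lexx _) dev).
rewrite -[3 / 2](_ : 2 - 2^-1 = _); last by field.
by rewrite lerD2r.
Qed.

(** The parallelogram law gives |1 + v|^2 = 4 - |v - 1|^2, and the right-hand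
    side here is the tangent bound on the square root. *)
Lemma norm_add1_le {C : numClosedFieldType} {v : C} :
  `|v| = 1 -> `|1 + v| <= 2 - `|v - 1| ^+ 2 / 4.
Proof.
move=> v1; set d := `|v - 1|.
have d0 : 0 <= d by exact: normr_ge0.
have d2 : d <= 2 by apply: le_trans (ler_normB _ _) _; rewrite v1 normr1.
have par : `|1 + v| ^+ 2 = 4 - d ^+ 2.
  have vv : v * v^* = 1 by rewrite -normCK v1 expr1n.
  rewrite /d !normCK !rmorphD rmorphN rmorph1 /=.
  have -> : (1 + v) * (1 + v^*) =
      4 - (v - 1) * (v^* - 1) + 2 * (v * v^* - 1) by ring.
  by rewrite vv subrr mulr0 addr0.
have nn : 0 <= 2 - d ^+ 2 / 4.
  rewrite subr_ge0 ler_pdivrMr ?ltr0n //.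
  apply: (@le_trans _ _ (2 ^+ 2)); first by rewrite lerXn2r ?nnegrE.
  by rewrite -natrX -natrM ler_nat.
rewrite -(@ler_pXn2r _ 2) ?nnegrE // par.
have -> : (2 - d ^+ 2 / 4) ^+ 2 = 4 - d ^+ 2 + (d ^+ 2 / 4) ^+ 2 by field.
by rewrite lerDl exprn_ge0 // mulr_ge0 ?exprn_ge0 ?invr_ge0.
Qed.

Lemma bernoulli_ineq {C : numDomainType} {c : C} (n : nat) :
  0 <= c -> n%:R * c <= (1 + c) ^+ n.
Proof.
move=> c0; suff H : 1 + n%:R * c <= (1 + c) ^+ n.
  by apply: le_trans H; rewrite lerDr.
elim: n => [|n IH]; first by rewrite mul0r addr0 expr0.
have h : 0 <= 1 + c by rewrite addr_ge0.
rewrite exprSr; apply: le_trans (ler_wpM2r h IH).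
rewrite -natr1.
have -> : (1 + n%:R * c) * (1 + c) =
    1 + (n%:R + 1) * c + n%:R * (c * c) by ring.
by rewrite lerDl !mulr_ge0.
Qed.

Lemma expr_unbounded {C : archiClosedFieldType} {c : C} (x : C) :
  0 < c -> exists n, `|x| < (1 + c) ^+ n.
Proof.
move=> c0; exists (Num.bound (`|x| / c)).
apply: lt_le_trans (bernoulli_ineq _ (ltW c0)).
by rewrite -ltr_pdivrMr // archi_boundP // mulr_ge0 // invr_ge0 ltW.
Qed.

(** If the orbit stayed within the threshold of [norm_expr_sub1_ge] from L0
    on, its distance to 1, which is positive, would grow geometrically. *)
Lemma unit_orbit_away_from_1 {C : archiClosedFieldType} {k : nat} {z : C}
    (L0 : nat) :
  (1 < k)%N -> `|z| = 1 -> (forall n, (0 < n)%N -> z ^+ n != 1) ->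
  exists2 L, (L0 <= L)%N & (2 * k ^ 2)%:R^-1 <= `|z ^+ (k ^ L) - 1|.
Proof.
move=> k1 z1 zn; set d : C := (2 * k ^ 2)%:R^-1.
have dR : d \is Num.real by rewrite realV realn.
have k0 : (0 < k)%N by exact: ltnW.
case: (pselect (exists2 L, (L0 <= L)%N & d <= `|z ^+ (k ^ L) - 1|)) => // no.
have small L : (L0 <= L)%N -> `|z ^+ (k ^ L) - 1| <= d.
  move=> h; rewrite real_leNgt ?normr_real //; apply/negP => /ltW dl.
  by apply: no; exists L.
set y := `|z ^+ (k ^ L0) - 1|.
have y0 : 0 < y by rewrite normr_gt0 subr_eq0 zn // expn_gt0 k0.
have grow n : (3 / 2) ^+ n * y <= `|z ^+ (k ^ (L0 + n)) - 1|.
  elim: n => [|n IH]; first by rewrite expr0 mul1r addn0.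
  rewrite addnS expnSr exprM.
  apply: le_trans (norm_expr_sub1_ge k1 _ _).
  - by rewrite exprS -mulrA ler_pM2l // mulr_gt0.
  - by rewrite normrX z1 expr1n.
  - by apply: small; rewrite leq_addr.
have h0 : (0 : C) < 2^-1 by rewrite invr_gt0.
have [n] := expr_unbounded (d / y) h0.
have dy0 : 0 <= d / y by rewrite mulr_ge0 // invr_ge0 // ltW.
rewrite ger0_norm // -[1 + 2^-1](_ : 3 / 2 = _); last by field.
rewrite ltr_pdivrMr // => /lt_le_trans /(_ (grow n)) /lt_le_trans.
by move=> /(_ _ (small _ (leq_addr _ _))); rewrite ltxx.
Qed.

(** * Reading the low digits of an integer *)

Definition digit {k : nat} (hk : (1 < k)%N) (n : nat) : 'I_k :=
  Ordinal (ltn_pmod n (ltnW hk)).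

(** Exactly L digits of r are read, padding with leading zeros: unlike
    [expansion], this composes well when integers are cut into blocks. *)
Fixpoint read_digits {k : nat} (hk : (1 < k)%N) {D : Type} {A : automaton k D}
    (L r : nat) (s : state A) : state A :=
  if L is L'.+1 then read_digits hk L' (r %/ k) (trans s (digit hk r)) else s.

Lemma digit_shift {k : nat} (hk : (1 < k)%N) (L r m : nat) :
  digit hk (r + k ^ L.+1 * m) = digit hk r.
Proof.
by apply: val_inj; rewrite /= expnS -mulnA [(k * _)%N]mulnC addnC modnMDl.
Qed.

Lemma divn_shift {k : nat} (hk : (1 < k)%N) (L r m : nat) :
  ((r + k ^ L.+1 * m) %/ k = r %/ k + k ^ L * m)%N.
Proof.
by rewrite expnS -mulnA [(k * _)%N]mulnC addnC divnMDl 1?addnC // ltnW.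
Qed.

Lemma read_digits_add {k : nat} (hk : (1 < k)%N) {D : Type} {A : automaton k D}
    (L j r m : nat) (s : state A) : (r < k ^ L)%N ->
  read_digits hk (L + j) (r + k ^ L * m) s =
    read_digits hk j m (read_digits hk L r s).
Proof.
elim: L r s => [|L IH] r s; first by case: r => //= _; rewrite expn0 mul1n.
move=> rL; rewrite addSn /= digit_shift divn_shift // IH //.
by rewrite ltn_divLR ?(ltnW hk) // -expnSr.
Qed.

(** Positivity of m matters: for m = 0 the expansion of r carries no leading
    zeros, whereas [read_digits] reads L digits. *)
Lemma trans_expansion_split {k : nat} (hk : (1 < k)%N) {D : Type}
    {A : automaton k D} (L r m : nat) (s : state A) :
    (0 < m)%N -> (r < k ^ L)%N ->
  trans_word s (expansion hk (r + k ^ L * m)) =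
    trans_word (read_digits hk L r s) (expansion hk m).
Proof.
move=> m0; elim: L r s => [|L IH] r s.
  by case: r => //= _; rewrite expn0 mul1n.
move=> rL; rewrite expansion_rcons; last first.
  by rewrite addn_gt0 muln_gt0 m0 expn_gt0 (ltnW hk) orbT.
rewrite /trans_word foldr_rcons -/(trans_word _ _) -/(digit hk _).
rewrite digit_shift divn_shift // IH //.
by rewrite ltn_divLR ?(ltnW hk) // -expnSr.
Qed.

(** * Exponential sums over blocks of digits *)

Definition state_sum {C : numFieldType} {k : nat} (hk : (1 < k)%N) {D : Type}
    {A : automaton k D} (L : nat) (u : C) (g : state A -> C) (s : state A) : C :=
  \sum_(r < k ^ L) u ^+ r * g (read_digits hk L r s).

(** B bounds the operator norm of [state_sum] for the supremum norm on functions
    of the state. *)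
Definition state_sum_bound {C : numFieldType} {k : nat} (hk : (1 < k)%N)
    {D : Type} (A : automaton k D) (L : nat) (u B : C) : Prop :=
  forall (M : C) (g : state A -> C), (forall s, `|g s| <= M) ->
    forall s, `|state_sum hk L u g s| <= B * M.

Lemma big_ord_mul {C : nmodType} (m n : nat) (F : nat -> C) :
  \sum_(i < m * n) F i = \sum_(q < n) \sum_(r < m) F (r + m * q)%N.
Proof.
elim: n => [|n IH]; first by rewrite muln0 !big_ord0.
rewrite mulnSr big_split_ord big_ord_recr /= IH; congr (_ + _).
by apply: eq_bigr => i _; rewrite addnC.
Qed.

(** Summing over the high digits first turns the sum over L + j digits into a
    composition of two operators, the second one with u replaced by
    u^(k^L). *)
Lemma state_sum_bound_add {C : numFieldType} {k : nat} {hk : (1 < k)%N}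
    {D : Type} {A : automaton k D} {L j : nat} {u B B' : C} :
  state_sum_bound hk A L u B -> state_sum_bound hk A j (u ^+ (k ^ L)) B' ->
  state_sum_bound hk A (L + j) u (B * B').
Proof.
move=> bL bj M g gM s.
have -> : state_sum hk (L + j) u g s =
    state_sum hk L u (state_sum hk j (u ^+ (k ^ L)) g) s.
  rewrite /state_sum expnD.
  rewrite (big_ord_mul _ _ (fun i => u ^+ i * g (read_digits hk (L + j) i s))).
  rewrite exchange_big; apply: eq_bigr => r _.
  rewrite mulr_sumr; apply: eq_bigr => q _.
  by rewrite read_digits_add // mulrA exprD exprM.
by rewrite -mulrA; apply: bL => t; apply: bj.
Qed.

Lemma state_sum_bound_trivial {C : numFieldType} {k : nat} (hk : (1 < k)%N)
    {D : Type} (A : automaton k D) (L : nat) {u : C} :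
  `|u| = 1 -> state_sum_bound hk A L u (k ^ L)%:R.
Proof.
move=> u1 M g gM s; apply: le_trans (ler_norm_sum _ _ _) _.
rewrite -[leRHS](_ : \sum_(i < k ^ L) M = _); last first.
  by rewrite sumr_const card_ord mulr_natl.
by apply: ler_sum => i _; rewrite normrM normrX u1 expr1n mul1r.
Qed.

(** Two words r < r' of length j lead from s to the same state, so their
    contributions add up to (u^r + u^r') g instead of being bounded separately;
    [norm_add1_le] then measures the gain. *)
Lemma state_sum_bound_pigeonhole {C : numClosedFieldType} {k : nat}
    (hk : (1 < k)%N) {D : Type} {A : automaton k D} {j : nat} {v eta : C} :
    (#|state A| < k ^ j)%N -> `|v| = 1 -> 0 <= eta ->
    (forall h, (0 < h < k ^ j)%N -> eta <= `|v ^+ h - 1|) ->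
  state_sum_bound hk A j v ((k ^ j)%:R - eta ^+ 2 / 4).
Proof.
move=> card v1 eta0 far M g gM s.
pose f (r : 'I_(k ^ j)) := read_digits hk j r s.
have M0 : 0 <= M by apply: le_trans (gM s).
have [r [r' [rr' fr]]] : exists r r' : 'I_(k ^ j), (r < r')%N /\ f r = f r'.
  have /injectivePn [x [y xy fxy]] : ~~ injectiveb f.
    by apply/injectiveP => /leq_card; rewrite card_ord leqNgt card.
  by case: (ltngtP x y) => [lt|lt|/val_inj eq];
    [exists x, y|exists y, x|rewrite eq eqxx in xy].
(* Isolate the two colliding terms and bound the others trivially. *)
have nr : r' != r by rewrite eq_sym neq_ltn rr'.
rewrite /state_sum (bigD1 r) //= (bigD1 r') //= addrA.
rewrite -/(f r) -/(f r') -fr -mulrDl.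
have head : `|(v ^+ r + v ^+ r') * g (f r)| <= (2 - eta ^+ 2 / 4) * M.
  rewrite normrM ler_pM //.
  rewrite -[v ^+ r in leLHS]mulr1 -(subnKC (ltnW rr')) exprD -mulrDr.
  rewrite normrM normrX v1 expr1n mul1r.
  apply: le_trans (norm_add1_le _) _; first by rewrite normrX v1 expr1n.
  rewrite lerB // ler_wpM2r ?invr_ge0 // lerXn2r ?nnegrE //.
  by apply: far; rewrite subn_gt0 rr' (leq_ltn_trans (leq_subr _ _)).
have tail : `|\sum_(i < k ^ j | (i != r) && (i != r')) v ^+ i * g (f i)| <=
    ((k ^ j)%:R - 2) * M.
  have -> : ((k ^ j)%:R - 2) * M = \sum_(i < k ^ j | (i != r) && (i != r')) M.
    have : \sum_(i < k ^ j) M = (k ^ j)%:R * M.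
      by rewrite sumr_const card_ord mulr_natl.
    by rewrite (bigD1 r) //= (bigD1 r') //= mulrBl => <-; ring.
  apply: le_trans (ler_norm_sum _ _ _) _.
  by apply: ler_sum => i _; rewrite normrM normrX v1 expr1n mul1r.
apply: le_trans (ler_normD _ _) _; apply: le_trans (lerD head tail) _.
by rewrite -mulrDl addrC addrA subrK.
Qed.

(** A gain by a factor 1 + c, uniform over infinitely many levels L: the
    factorial Q below is a common multiple of the differences h of
    [state_sum_bound_pigeonhole], so one recurrence statement for w^Q controls
    all u^h at once, with a loss of at most the factor Q. *)
Lemma state_sum_bound_step {C : archiClosedFieldType} {k : nat} (hk : (1 < k)%N)
    {D : Type} (A : automaton k D) {w : C} :
    `|w| = 1 -> (forall n, (0 < n)%N -> w ^+ n != 1) ->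
  exists2 c : C, 0 < c &
    exists j, forall L0, exists2 L, (L0 <= L)%N &
      state_sum_bound hk A j (w ^+ (k ^ L)) ((k ^ j)%:R / (1 + c)).
Proof.
move=> w1 wn; pose j := #|state A|; pose Q := (k ^ j)`!.
have kj0 : 0 < (k ^ j)%:R :> C by rewrite ltr0n expn_gt0 (ltnW hk).
have Q0 : 0 < Q%:R :> C by rewrite ltr0n fact_gt0.
pose d : C := (2 * k ^ 2)%:R^-1.
have d0 : 0 < d by rewrite invr_gt0 ltr0n muln_gt0 expn_gt0 (ltnW hk).
pose eta := d / Q%:R.
have eta0 : 0 < eta by rewrite divr_gt0.
(* The pigeonhole bound is k^j (1 - c), and 1 - c <= 1 / (1 + c); the latter
   form suits the divergence of (1 + c)^n. *)
pose c := eta ^+ 2 / 4 / (k ^ j)%:R.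
have c0 : 0 < c by rewrite !divr_gt0 // exprn_gt0.
exists c => //; exists j => L0.
have wQ1 : `|w ^+ Q| = 1 by rewrite normrX w1 expr1n.
have wQn n : (0 < n)%N -> (w ^+ Q) ^+ n != 1.
  by move=> n0; rewrite -exprM wn // muln_gt0 fact_gt0.
have [L L0L far] := unit_orbit_away_from_1 L0 hk wQ1 wQn; exists L => //.
set u := w ^+ (k ^ L).
have u1 : `|u| = 1 by rewrite normrX w1 expr1n.
have ufar h : (0 < h < k ^ j)%N -> eta <= `|u ^+ h - 1|.
  move=> /andP[h0 hkj]; rewrite ler_pdivrMr //.
  have hQ : (h %| Q)%N by rewrite dvdn_fact // h0 ltnW.
  apply: le_trans far _; rewrite -exprM mulnC exprM -/u -(divnK hQ) mulnC exprM.
  have uh1 : `|u ^+ h| = 1 by rewrite normrX u1 expr1n.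
  apply: le_trans (norm_expr_sub1_le _ uh1) _.
  by rewrite mulrC ler_wpM2l // ler_nat leq_pmull.
move=> M g gM s.
have M0 : 0 <= M by apply: le_trans (gM s).
apply: le_trans (state_sum_bound_pigeonhole hk _ u1 (ltW eta0) ufar M g gM s) _.
  exact: ltn_expl.
rewrite ler_wpM2r // ler_pdivlMr ?addr_gt0 //.
have -> : (k ^ j)%:R - eta ^+ 2 / 4 = (k ^ j)%:R * (1 - c).
  by rewrite /c; field; rewrite lt0r_neq0.
rewrite -mulrA ler_piMr ?(ltW kj0) //.
have -> : (1 - c) * (1 + c) = 1 - c * c by ring.
by rewrite gerDl oppr_le0 mulr_ge0 // ltW.
Qed.

(** Between two gaining levels the trivial bound loses nothing relative to
    k^L, so the gains accumulate. *)
Lemma state_sum_bound_small {C : archiClosedFieldType} {k : nat} (hk : (1 < k)%N)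
    {D : Type} (A : automaton k D) {w eps : C} :
    `|w| = 1 -> (forall n, (0 < n)%N -> w ^+ n != 1) -> 0 < eps ->
  exists L, state_sum_bound hk A L w ((k ^ L)%:R * eps).
Proof.
move=> w1 wn eps0.
have [c c0 [j step]] := state_sum_bound_step hk A w1 wn.
have c1 : 0 < 1 + c by rewrite addr_gt0.
have iter n : exists L, state_sum_bound hk A L w ((k ^ L)%:R / (1 + c) ^+ n).
  elim: n => [|n [L bL]].
    by exists 0%N; rewrite divr1; apply: state_sum_bound_trivial.
  have [L' LL' bj] := step L; exists (L' + j)%N.
  have wL1 : `|w ^+ (k ^ L)| = 1 by rewrite normrX w1 expr1n.
  have := state_sum_bound_add bL (state_sum_bound_trivial hk A (L' - L) wL1).
  rewrite subnKC // => bL'; have := state_sum_bound_add bL' bj.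
  congr (state_sum_bound _ _ _ _ _).
  rewrite -{2}(subnKC LL') !expnD !natrM exprS.
  by field; rewrite expf_neq0 lt0r_neq0.
have [n hn] := expr_unbounded eps^-1 c0.
have [L bL] := iter n; exists L => M g gM s.
have M0 : 0 <= M by apply: le_trans (gM s).
apply: le_trans (bL M g gM s) _; rewrite ler_wpM2r // ler_wpM2l //.
move: hn; rewrite ger0_norm ?invr_ge0 ?(ltW eps0) // => /ltW.
by rewrite -[leRHS]invrK lef_pV2 // posrE ?invr_gt0 ?exprn_gt0.
Qed.

(** * From blocks to averages *)

Lemma norm_sum_blocks_le {C : numDomainType} {f : nat -> C} {A B : C} {K : nat}
    (N : nat) : (0 < K)%N -> 0 <= B ->
    (forall n, `|f n| <= A) ->
    (forall m, (0 < m)%N -> `|\sum_(r < K) f (r + K * m)%N| <= K%:R * B) ->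
  `|\sum_(n < N) f n| <= 2 * K%:R * A + N%:R * B.
Proof.
move=> K0 B0 fA fB.
have A0 : 0 <= A by apply: le_trans (fA 0%N).
have short n m : (n <= K)%N -> `|\sum_(r < n) f (r + m)%N| <= K%:R * A.
  move=> nK; apply: le_trans (ler_norm_sum _ _ _) _.
  apply: (@le_trans _ _ (\sum_(r < n) A)); first exact: ler_sum.
  by rewrite sumr_const card_ord -[A *+ _]mulr_natl ler_wpM2r // ler_nat.
have full q : `|\sum_(n < K * q) f n| <= K%:R * A + (K * q)%:R * B.
  elim: q => [|q IH].
    by rewrite muln0 big_ord0 normr0 mul0r addr0 mulr_ge0.
  rewrite mulnSr big_split_ord /=; apply: le_trans (ler_normD _ _) _.
  under [X in _ + `|X|]eq_bigr => i _ do rewrite addnC.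
  (* Only the first block lacks the bound fB; it accounts for one K A. *)
  case: q IH => [|q] IH.
    rewrite muln0 big_ord0 normr0 add0r add0n.
    by apply: le_trans (short K 0%N (leqnn _)) _; rewrite lerDl mulr_ge0.
  apply: le_trans (lerD IH (fB q.+1 _)) _ => //.
  by rewrite natrD mulrDl addrA.
rewrite -(big_mkord xpredT) {1}(divn_eq N K) mulnC big_mkord big_split_ord /=.
apply: le_trans (ler_normD _ _) _.
under [X in _ + `|X|]eq_bigr => i _ do rewrite addnC.
have tK : (N %% K <= K)%N by rewrite ltnW // ltn_pmod.
apply: le_trans (lerD (full _) (short _ _ tK)) _.
have -> : 2 * K%:R * A + N%:R * B = K%:R * A + N%:R * B + K%:R * A by ring.
by rewrite lerD2r lerD2l ler_wpM2r // ler_nat mulnC leq_divM.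
Qed.

Lemma automatic_mean_small {C : archiClosedFieldType} {k : nat} {hk : (1 < k)%N}
    {a : nat -> C} {w eps : C} : automatic hk a ->
    `|w| = 1 -> (forall n, (0 < n)%N -> w ^+ n != 1) -> 0 < eps ->
  exists N0, forall N, (N0 <= N)%N ->
    `|mean (fun n => a n * w ^+ n) N| <= eps.
Proof.
move=> [A aE] w1 wn eps0.
have [M M0 outM] : exists2 M : C, 0 < M & forall s : state A, `|out s| <= M.
  exists (1 + \sum_(s : state A) `|out s|).
    by rewrite ltr_pwDl // sumr_ge0.
  move=> s; rewrite (bigD1 s) //= addrCA lerDl addr_ge0 // sumr_ge0 // => t _.
have e0 : 0 < eps / 2 / M by rewrite !divr_gt0.
have [L bL] := state_sum_bound_small hk A w1 wn e0.
have K0 : (0 < k ^ L)%N by rewrite expn_gt0 (ltnW hk).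
pose f n := a n * w ^+ n.
have fM n : `|f n| <= M by rewrite normrM normrX w1 expr1n mulr1 aE.
have fB m : (0 < m)%N ->
    `|\sum_(r < k ^ L) f (r + k ^ L * m)%N| <= (k ^ L)%:R * (eps / 2).
  move=> m0; pose g s := out (trans_word (A := A) s (expansion hk m)).
  have -> : \sum_(r < k ^ L) f (r + k ^ L * m)%N =
      w ^+ (k ^ L * m) * state_sum hk L w g (init A).
    rewrite mulr_sumr; apply: eq_bigr => r _.
    by rewrite /f aE trans_expansion_split // exprD /g; ring.
  rewrite normrM normrX w1 expr1n mul1r.
  apply: le_trans (bL M g _ (init A)) _ => //; first by move=> s; apply: outM.
  by rewrite -[leLHS]mulrA divfK ?lt0r_neq0.
have h0 : 0 <= eps / 2 by rewrite divr_ge0 // ltW.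
(* Beyond x, the first and last blocks contribute at most eps / 2. *)
pose x := 2 * (k ^ L)%:R * M / (eps / 2).
exists (Num.bound x).+1 => N NN.
have N0 : 0 < N%:R :> C by rewrite ltr0n; case: N NN.
rewrite /mean normrM normfV normr_nat mulrC ler_pdivrMr //.
apply: le_trans (norm_sum_blocks_le N K0 h0 fM fB) _.
have -> : eps * N%:R = N%:R * (eps / 2) + N%:R * (eps / 2) by field.
rewrite lerD2r -ler_pdivrMr ?divr_gt0 //.
have x0 : 0 <= x by rewrite /x !mulr_ge0 ?invr_ge0 // ltW.
by apply: le_trans (ltW (archi_boundP x0)) _; rewrite ler_nat ltnW.
Qed.

(** * The character e *)

Lemma complex_archimedean (R : realType) : Num.archimedean_axiom R[i].
Proof.
move=> z; exists (Num.bound (Num.sqrt (complex.Re z ^+ 2 + complex.Im z ^+ 2))).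
rewrite normc_def -(rmorph_nat (real_complex R)) ltcR.
by rewrite archi_boundP // sqrtr_ge0.
Qed.

(** Gives R[i] the archimedean closed field structure that
    [automatic_mean_small] is stated over. *)
HB.instance Definition _ (R : realType) :=
  Num.NumDomain_bounded_isArchimedean.Build R[i] (@complex_archimedean R).

Lemma norm_e {R : realType} (x : R) : `|e x| = 1.
Proof. by rewrite normc_def /= cos2Dsin2 sqrtr1. Qed.

Lemma e0 {R : realType} : e 0 = 1 :> R[i].
Proof. by rewrite /e mulr0 cos0 sin0. Qed.

Lemma eD {R : realType} (x y : R) : e (x + y) = e x * e y.
Proof. by rewrite /e mulrDr cosD sinD; congr (_ +i* _); rewrite addrC. Qed.

Lemma e_natmul {R : realType} (x : R) (n : nat) : e (n%:R * x) = e x ^+ n.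
Proof.
elim: n => [|n IH].
  by rewrite mul0r expr0 e0.
by rewrite exprSr -IH -natr1 mulrDl mul1r eD.
Qed.

Lemma e_int {R : realType} (m : int) : e (m%:~R : R) = 1.
Proof.
have e1 : e (1 : R) = 1 by rewrite /e mulr1 mulr_natl cos2pi sin2pi.
have eN n : e (n%:R : R) = 1 by rewrite -[n%:R]mulr1 e_natmul e1 expr1n.
case: m => n; first exact: eN.
by rewrite NegzE mulrNz -[LHS]mul1r -{1}(eN n.+1) -eD subrr e0.
Qed.

(** After subtracting the integer part, cos (2 pi y) = 1 forces
    sin (pi y) = 0 with 0 <= y < 1, whereas sin is positive on ]0, pi[. *)
Lemma e_eq1 {R : realType} {x : R} : e x = 1 -> exists m : int, x = m%:~R.
Proof.
move=> ex1; exists (Num.floor x); apply/eqP; rewrite -subr_eq0.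
have /andP[fx xf] := floor_itv x; set y := x - _.
have y0 : 0 <= y by rewrite subr_ge0.
have y1 : y < 1 by rewrite ltrBlDl -(intrD _ _ 1).
have : e y = 1.
  by rewrite -ex1 -[LHS]mulr1 -(e_int (Num.floor x)) -eD subrK.
move=> [c1 _]; apply: contraT => yn0.
have yp : 0 < y by rewrite lt0r yn0.
have sp : 0 < sin (pi * y).
  by rewrite sin_gt0_pi // mulr_gt0 ?pi_gt0 //= gtr_pMr ?pi_gt0.
have := cos2Dsin2 (pi * y).
move: c1; rewrite -mulrA mulr_natl cos_mulr2n => c1 cs.
have : sin (pi * y) ^+ 2 = 0 by lra.
by move/eqP; rewrite sqrf_eq0 gt_eqF.
Qed.

Lemma e_irrational {R : realType} {alpha : R} (n : nat) :
  irrational alpha -> (0 < n)%N -> e alpha ^+ n != 1.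
Proof.
move=> irr n0; apply/eqP; rewrite -e_natmul => /e_eq1 [m nam].
apply: irr; exists (m%:~R / n%:R) => //.
rewrite fmorph_div rmorph_int rmorph_nat -nam mulrC mulKf //.
by rewrite pnatr_eq0 -lt0n.
Qed.

Theorem proposition5p1 (R : realType) (k : nat) (hk : (1 < k)%N)
    (a : nat -> R[i]) (ha : automatic hk a) (alpha : R)
    (halpha : irrational alpha) :
  (mean (fun n => a n * e (n%:R * alpha)) : nat -> R[i]^o) @ \oo
    --> (0 : R[i]^o).
Proof.
apply/cvgrPdist_le => eps eps0.
have [N0 hN] := automatic_mean_small ha (norm_e alpha)
  (fun n => e_irrational n halpha) eps0.
exists N0 => // N /= /hN; rewrite sub0r normrN.
by congr (`|mean _ _| <= _); apply/funext => n; rewrite e_natmul.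
Qed.
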